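(* Let $R$ be a Kähler algebraic curvature operator on a complex Euclidean vector space $(V,g,J)$ of complex dimension $m\geq2$. (1) If $R$ has $\frac{3}{2}(m^2-1)$-nonnegative (respectively, $\frac{3}{2}(m^2-1)$-nonpositive) curvature operator of the second kind, then $R$ has constant nonnegative (respectively, nonpositive) holomorphic sectional curvature. (2) If $R$ has $\alpha$-nonnegative (respectively, $\alpha$-nonpositive) curvature operator of the second kind for some $\alpha<\frac{3}{2}(m^2-1)$, then $R$ is flat, i.e. $R=0$.
   Context: A complex Euclidean vector space $(V,g,J)$ of complex dimension $m$ is a real inner product space $(V,g)$ of real dimension $2m$ with an endomorphism $J$ satisfying $J^2=-\operatorname{id}$ and $g(JX,JY)=g(X,Y)$. An algebraic curvature operator on $V$ is a 4-linear form $R$ on $V$ with $R(X,Y,Z,W)=-R(Y,X,Z,W)=-R(X,Y,W,Z)=R(Z,W,X,Y)$ and satisfying the first Bianchi identity $R(X,Y,Z,W)+R(Y,Z,X,W)+R(Z,X,Y,W)=0$. It is called Kähler if moreover $R(X,Y,Z,W)=R(X,Y,JZ,JW)$ for all $X,Y,Z,W\in V$. The sign convention is that $R(X,Y,X,Y)$ is the sectional curvature for orthonormal $X,Y$. Let $n=2m$, let $S^2_0(V)$ be the space of traceless symmetric two-tensors on $V$ with inner product $\langle A,B\rangle=\operatorname{tr}(A^TB)$, and $N=\dim S^2_0(V)=\frac{(n-1)(n+2)}{2}$. The curvature operator of the second kind of $R$ is the symmetric bilinear form on $S^2_0(V)$ given in an orthonormal basis of $V$ by $\mathring{R}(\varphi,\psi)=\sum_{i,j,k,l=1}^n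 R_{ijkl}\varphi_{il}\psi_{jk}$. For a real $\alpha\in[1,N]$, $R$ has $\alpha$-nonnegative curvature operator of the second kind if for every orthonormal basis $\{\varphi_i\}_{i=1}^N$ of $S^2_0(V)$, $$\sum_{i=1}^{\lfloor\alpha\rfloor}\mathring{R}(\varphi_i,\varphi_i)+(\alpha-\lfloor\alpha\rfloor)\mathring{R}(\varphi_{\lfloor\alpha\rfloor+1},\varphi_{\lfloor\alpha\rfloor+1})\geq0,$$ where the last term is absent when $\alpha$ is an integer; $R$ has $\alpha$-nonpositive curvature operator of the second kind if $-R$ has $\alpha$-nonnegative curvature operator of the second kind. $R$ has constant holomorphic sectional curvature $c$ if $R(X,JX,X,JX)=c$ for all unit $X\in V$. *)

(* Defs.v *)
From HB Require Import structures.
From mathcomp Require Import all_boot all_order all_algebra.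
From mathcomp Require Import reals.

Set Implicit Arguments.
Unset Strict Implicit.
Unset Printing Implicit Defensive.

Import Order.TTheory GRing.Theory Num.Theory.
Local Open Scope ring_scope.

Section KahlerCurvature.
Variables (R : realType) (V : vectType R).
Implicit Types (g : {dot V for idfun}) (J : 'End(V)) (Rm : V -> V -> V -> V -> R).

Definition complex_euclidean (m : nat) g J : Prop :=
  [/\ \dim {:V} = (2 * m)%N,
      forall X, J (J X) = - X
    & forall X Y, g (J X) (J Y) = g X Y].

Definition four_linear Rm : Prop :=
  [/\ forall Y Z W, scalar (fun X => Rm X Y Z W),
      forall X Z W, scalar (fun Y => Rm X Y Z W),
      forall X Y W, scalar (fun Z => Rm X Y Z W)
    & forall X Y Z, scalar (fun W => Rm X Y Z W)].

Definition algebraic_curvature Rm : Prop :=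
  [/\ four_linear Rm,
      forall X Y Z W, Rm X Y Z W = - Rm Y X Z W,
      forall X Y Z W, Rm X Y Z W = - Rm X Y W Z,
      forall X Y Z W, Rm X Y Z W = Rm Z W X Y
    & forall X Y Z W, Rm X Y Z W + Rm Y Z X W + Rm Z X Y W = 0].

Definition kahler_curvature J Rm : Prop :=
  algebraic_curvature Rm /\ forall X Y Z W, Rm X Y Z W = Rm X Y (J Z) (J W).

Definition constant_holomorphic_curvature g J Rm (c : R) : Prop :=
  forall X, g X X = 1 -> Rm X (J X) X (J X) = c.

Section Dimension.
Variable n : nat.

Definition orthonormal_basis g (e : n.-tuple V) : Prop :=
  basis_of {:V} e /\
  forall i j : 'I_n, g (tnth e i) (tnth e j) = (i == j)%:R.

(* Two-tensors on V are given by their matrices of components in an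
   orthonormal basis of V. *)
Definition S20 : {vspace 'M[R]_n} :=
  (lker (linfun (idfun \- trmx : 'M[R]_n -> 'M[R]_n)) :&:
   lker (linfun (mxtrace : 'M[R]_n -> R^o)))%VS.

Lemma memS20 (A : 'M[R]_n) : (A \in S20) = (A^T == A) && (\tr A == 0).
Proof. by rewrite memv_cap !memv_ker !lfunE /= subr_eq0 eq_sym. Qed.

Definition dimS20 : nat := (n.-1 * n.+2)./2.

Definition S20_orthonormal_basis (phi : dimS20.-tuple 'M[R]_n) : Prop :=
  basis_of S20 phi /\
  forall i j : 'I_dimS20,
    \tr ((tnth phi i)^T *m tnth phi j) = (i == j)%:R.

Definition curvature_second_kind Rm (e : n.-tuple V) (phi psi : 'M[R]_n) : R :=
  \sum_(i < n) \sum_(j < n) \sum_(k < n) \sum_(l < n)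
    Rm (tnth e i) (tnth e j) (tnth e k) (tnth e l) * phi i l * psi j k.

(* Indices start at 0, so phi`_k is the (floor alpha + 1)-st element. If
   alpha = dimS20 it is the default value 0, with coefficient alpha - k = 0.
   The form does not depend on the orthonormal basis e of V. *)
Definition alpha_nonnegative g Rm (alpha : R) : Prop :=
  forall (e : n.-tuple V) (phi : dimS20.-tuple 'M[R]_n),
    orthonormal_basis g e -> S20_orthonormal_basis phi ->
    let k := Num.truncn alpha in
    0 <= \sum_(0 <= i < k) curvature_second_kind Rm e phi`_i phi`_i
         + (alpha - k%:R) * curvature_second_kind Rm e phi`_k phi`_k.

Definition alpha_nonpositive g Rm (alpha : R) : Prop :=
  alpha_nonnegative g (fun X Y Z W => - Rm X Y Z W) alpha.

End Dimension.
End KahlerCurvature.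

(* Main.v *)
Require Import Defs.
From HB Require Import structures.
From mathcomp Require Import all_boot all_order all_algebra.
From mathcomp Require Import reals ring lra zify.
Import Order.TTheory GRing.Theory Num.Theory.
Local Open Scope ring_scope.

(** Split the traceless symmetric tensors into their J-invariant part, of
    dimension d = m^2 - 1, and their J-anti-invariant part, of dimension
    D = m^2 + m.  Contracting R with the two projections and using the Bianchi
    identity, the form of the second kind has trace S (the scalar curvature) on
    the anti-invariant part and - (m - 1) / (2 m) S on the invariant part.

    Alpha-nonnegativity says that every weighted sum of the diagonal values in
    an orthonormal basis is nonnegative, for weights in [0, 1] of total mass
    alpha.  If alpha <= 3/2 (m^2 - 1), weights in proportion 1 : (m - 1) / (2 m)
    on the two parts are admissible and give the sum 0.  Moving a little mass
    onto, or away from, one anti-invariant unit tensor cannot make it negative,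
    so the form takes the value S / D at every such tensor; at
    (X X - JX JX) / sqrt 2 this value is the holomorphic sectional curvature of
    X.  Equal weights give S >= 0.  If alpha < 3/2 (m^2 - 1), moving mass to the
    invariant part gives S <= 0; then the holomorphic sectional curvature is 0
    and R = 0 by polarisation. *)

Set Implicit Arguments.
Unset Strict Implicit.
Unset Printing Implicit Defensive.

(** * Linear forms given as functions with the property [scalar] *)

Section ScalarForms.
Variables (R : comNzRingType) (V : lmodType R) (f : V -> R).
Hypothesis flin : scalar f.

Lemma scalar_formD x y : f (x + y) = f x + f y.
Proof. by have := flin 1 x y; rewrite scale1r mul1r. Qed.

Lemma scalar_form0 : f 0 = 0.
Proof. by apply: (addrI (f 0)); rewrite -scalar_formD !addr0. Qed.

Lemma scalar_formZ a x : f (a *: x) = a * f x.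
Proof. by have := flin a x 0; rewrite scalar_form0 !addr0. Qed.

Lemma scalar_formN x : f (- x) = - f x.
Proof. by rewrite -scaleN1r scalar_formZ mulN1r. Qed.

Lemma scalar_form_sum (I : Type) (r : seq I) (c : I -> R) (v : I -> V) :
  f (\sum_(i <- r) c i *: v i) = \sum_(i <- r) c i * f (v i).
Proof.
elim: r => [|i r IH]; first by rewrite !big_nil scalar_form0.
by rewrite !big_cons scalar_formD scalar_formZ IH.
Qed.

End ScalarForms.

(** * Gram-Schmidt orthonormalisation and orthogonal projection *)

Section GramSchmidt.
Variables (R : realType) (V : vectType R).
Implicit Types (s t : seq V) (U : {vspace V}).

(** A predicate on bare functions, so that the same results serve the metric on V and the Frobenius
    product on matrices. *)
Definition inner_product (g : V -> V -> R) : Prop :=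
  [/\ forall y, scalar (g^~ y), forall x y, g x y = g y x
    & forall x, x != 0 -> 0 < g x x].

(** Phrased through membership and not positions, so that it is stable under sorting and splits well
    along concatenations. *)
Definition orthonormal_seq (g : V -> V -> R) s : Prop :=
  uniq s /\ {in s &, forall x y, g x y = (x == y)%:R}.

Variable g : V -> V -> R.
Hypothesis gI : inner_product g.

Lemma inner_linl y : scalar (g^~ y). Proof. by case: gI. Qed.
Lemma inner_sym x y : g x y = g y x. Proof. by case: gI. Qed.
Lemma inner_linr x : scalar (g x).
Proof.
by move=> a y z; rewrite inner_sym (inner_linl x a y z) !(inner_sym _ x).
Qed.

Lemma inner_definite x : g x x = 0 -> x = 0.
Proof.
move=> gx0; apply/eqP/negPn/negP => x0.
by case: gI => _ _ /(_ _ x0); rewrite gx0 ltxx.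
Qed.

Lemma orthonormal_seq_nth s i j : orthonormal_seq g s ->
  (i < size s)%N -> (j < size s)%N -> g s`_i s`_j = (i == j)%:R.
Proof.
by move=> [us os] hi hj; rewrite os ?mem_nth // nth_uniq.
Qed.

Lemma orthonormal_seq_perm s t :
  perm_eq s t -> orthonormal_seq g s -> orthonormal_seq g t.
Proof.
move=> st [us os]; split; first by rewrite -(perm_uniq st).
by move=> x y; rewrite -!(perm_mem st); apply: os.
Qed.

Lemma inner_span s w : {in s, forall x, g x w = 0} ->
  forall v, v \in <<s>>%VS -> g v w = 0.
Proof.
move=> sw v vs; rewrite (coord_span (X := in_tuple s) vs).
rewrite (scalar_form_sum (inner_linl w)) big1 // => i _.
by rewrite sw ?mulr0 // mem_nth // -[X in (_ < X)%N](size_tuple (in_tuple s)).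
Qed.

Lemma inner_coord s x (c : V -> R) : orthonormal_seq g s -> x \in s ->
  g x (\sum_(y <- s) c y *: y) = c x.
Proof.
move=> [us os] xs; rewrite (scalar_form_sum (inner_linr x)).
rewrite (bigD1_seq x) //= os // eqxx mulr1 big1_seq ?addr0 // => y /andP[yx ys].
by rewrite os // eq_sym (negbTE yx) mulr0.
Qed.

Lemma span_sum s (c : V -> R) : \sum_(y <- s) c y *: y \in <<s>>%VS.
Proof.
by rewrite big_seq; apply: rpred_sum => y ys; apply/rpredZ/memv_span.
Qed.

Lemma orthonormal_seq_expand s v : orthonormal_seq g s -> v \in <<s>>%VS ->
  \sum_(x <- s) g x v *: x = v.
Proof.
move=> os vs; apply/esym/eqP; rewrite -subr_eq0; apply/eqP/inner_definite.
apply: (@inner_span s) => [x xs|]; last by rewrite rpredB // span_sum.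
rewrite (scalar_formD (inner_linr x)) (scalar_formN (inner_linr x)).
by rewrite inner_coord // subrr.
Qed.

Lemma orthonormal_seq_free s : orthonormal_seq g s -> free s.
Proof.
move=> os; apply/(@freeP _ _ _ (in_tuple s)) => k k0 i.
have /= := congr1 (g s`_i) k0.
rewrite (scalar_form_sum (inner_linr _)) (scalar_form0 (inner_linr _)) (bigD1
  i) //=.
rewrite big1 => [|j ji]; rewrite orthonormal_seq_nth ?ltn_ord ?eqxx //.
  by rewrite mulr1 addr0.
by rewrite (inj_eq val_inj) eq_sym (negbTE ji) mulr0.
Qed.

(** Induction on the codimension of the span of [s] in [U]: as long as some v in [U] lies outside
    the span, its component [w] orthogonal to [s] is nonzero and, once normalised, can be
    appended. *)
Lemma orthonormal_seq_extend U s : orthonormal_seq g s ->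
  {subset s <= U} ->
  exists t, orthonormal_seq g (s ++ t) /\ basis_of U (s ++ t).
Proof.
have [k] := ubnP (\dim U - size s)%N; elim: k s => // k IH s lek os sU.
have sUs : (<<s>> <= U)%VS by apply/span_subvP.
have fs := orthonormal_seq_free os.
have [eqs|] := eqVneq <<s>>%VS U.
  by exists [::]; rewrite cats0; split=> //; rewrite /basis_of eqs eqxx.
rewrite eqEsubv sUs /= => /subvPn[v vU vs].
have ds : (size s < \dim U)%N.
  rewrite -(eqP fs) ltn_neqAle dimvS // andbT; apply/eqP => e.
  by case/negP: vs; rewrite (_ : <<s>>%VS = U) //; apply/eqP;
    rewrite eqEdim sUs e /=.
pose w := v - \sum_(x <- s) g x v *: x.
have w0 : w != 0.
  by apply: contra vs; rewrite subr_eq0 => /eqP->; apply: span_sum.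
have sw : {in s, forall x, g x w = 0}.
  move=> x xs; rewrite /w (scalar_formD (inner_linr x)) (scalar_formN
    (inner_linr x)).
  by rewrite inner_coord // subrr.
have gw : 0 < g w w by case: gI => _ _; apply.
pose z := (Num.sqrt (g w w))^-1 *: w.
have sz : {in s, forall x, g x z = 0}.
  by move=> x xs; rewrite /z (scalar_formZ (inner_linr x)) (sw x) ?mulr0.
have zz : g z z = 1.
  rewrite {2}/z (scalar_formZ (inner_linr z)) /z (scalar_formZ (inner_linl w)).
  rewrite mulrA -expr2 exprVn sqr_sqrtr ?ltW // mulVf //; exact: lt0r_neq0.
have zs : z \notin s.
  by apply/negP => /sz; rewrite zz => /eqP; rewrite oner_eq0.
have oz : orthonormal_seq g (rcons s z).
  split; first by rewrite rcons_uniq zs; case: os.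
  move=> x y; rewrite !mem_rcons !inE.
  case/predU1P=> [->|xs]; case/predU1P=> [->|ys].
  - by rewrite eqxx zz.
  - by rewrite inner_sym sz // eq_sym (negbTE (memPn zs _ ys)).
  - by rewrite sz // (negbTE (memPn zs _ xs)).
  - by case: os => _; apply.
have zU : z \in U.
  apply/rpredZ/rpredB => //; exact: (subvP sUs _ (span_sum s (g^~ v))).
case: (IH (rcons s z)) => //.
- by rewrite size_rcons; lia.
- by move=> x; rewrite mem_rcons inE => /predU1P[->|/sU].
by move=> t; rewrite cat_rcons => ht; exists (z :: t).
Qed.

(** The hypotheses on [p] characterise the orthogonal projection of [a] to [U], so a closed formula
    for the projection replaces the sum over any orthonormal basis. *)
Lemma orthonormal_seq_proj U s a p : orthonormal_seq g s -> basis_of U s ->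
  p \in U -> (forall b, b \in U -> g b (a - p) = 0) ->
  \sum_(x <- s) g x a *: x = p.
Proof.
move=> os bU pU hp; rewrite -[RHS](orthonormal_seq_expand os); last first.
  by rewrite (span_basis bU).
apply: eq_big_seq => x xs; congr (_ *: _); apply/eqP; rewrite -subr_eq0.
by rewrite -(scalar_formN (inner_linr x)) -(scalar_formD (inner_linr x)) hp
  ?(basis_mem bU).
Qed.

End GramSchmidt.

(* The partial sum over the sorted sequence is the minimum, over all weights in
   [0, 1] of total mass alpha, of the weighted sum; F s`_k is the dual
   variable. *)
Lemma sorted_weighted_sum_ge0 (R : realType) (T : zmodType) (F w : T -> R)
    (s : seq T) (k : nat) (alpha : R) :
  sorted (fun x y => F x <= F y) s -> (k < size s)%N ->
  {in s, forall x, 0 <= w x <= 1} -> \sum_(x <- s) w x = alpha ->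
  0 <= \sum_(0 <= i < k) F s`_i + (alpha - k%:R) * F s`_k ->
  0 <= \sum_(x <- s) w x * F x.
Proof.
move=> ss ks w01 wa /le_trans; apply; set t := F s`_k.
have -> : \sum_(0 <= i < k) F s`_i + (alpha - k%:R) * t =
    \sum_(0 <= i < k) (F s`_i - t) + alpha * t.
  rewrite sumrB big_const_nat subn0 iter_addr_0 -mulr_natl; ring.
have -> : \sum_(x <- s) w x * F x = \sum_(x <- s) w x * (F x - t) + alpha * t.
  rewrite -wa mulr_suml -big_split; apply: eq_bigr => x _ /=; ring.
have ks1 := ltnW ks.
rewrite lerD2r [leRHS](big_nth 0) [leRHS](big_cat_nat (n := k)) //=.
have leF i j : (i <= j)%N -> (j < size s)%N -> F s`_i <= F s`_j.
  move=> ij js; apply: (sorted_leq_nth _ _ 0 ss) => //.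
  - by move=> y x z; apply: le_trans.
  - exact: (leq_ltn_trans ij).
(* After subtracting [t], the terms before position k are nonpositive, and a weight at most 1 only
   raises them; the terms from k on are nonnegative. *)
rewrite -[X in X <= _]addr0; apply: lerD.
  apply: ler_sum_nat => i /andP[_ ik];
    have /andP[_ w1] := w01 _ (mem_nth 0 (ltn_trans ik ks)).
  have := leF i k (ltnW ik) ks; rewrite -/t; nra.
rewrite big_nat_cond; apply: sumr_ge0 => i /andP[/andP[ki is_] _].
have /andP[w0 _] := w01 _ (mem_nth 0 is_).
by rewrite mulr_ge0 // subr_ge0 leF.
Qed.

(** * Symmetries of Kähler curvature and polarisation *)

Section KahlerIdentities.
Variables (R : realType) (V : vectType R) (J : 'End(V)).
Variable Rm : V -> V -> V -> V -> R.
Hypothesis JJ : forall X, J (J X) = - X.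
Hypothesis hR : kahler_curvature J Rm.

Lemma curvature_lin1 Y Z W : scalar (fun X => Rm X Y Z W).
Proof. by case: hR => [[[]]]. Qed.
Lemma curvature_lin2 X Z W : scalar (fun Y => Rm X Y Z W).
Proof. by case: hR => [[[]]]. Qed.
Lemma curvature_lin3 X Y W : scalar (fun Z => Rm X Y Z W).
Proof. by case: hR => [[[]]]. Qed.
Lemma curvature_lin4 X Y Z : scalar (fun W => Rm X Y Z W).
Proof. by case: hR => [[[]]]. Qed.

Lemma curvature_anti12 X Y Z W : Rm X Y Z W = - Rm Y X Z W.
Proof. by case: hR => [[]]. Qed.
Lemma curvature_anti34 X Y Z W : Rm X Y Z W = - Rm X Y W Z.
Proof. by case: hR => [[]]. Qed.
Lemma curvature_pair X Y Z W : Rm X Y Z W = Rm Z W X Y.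
Proof. by case: hR => [[]]. Qed.
Lemma curvature_bianchi X Y Z W : Rm X Y Z W + Rm Y Z X W + Rm Z X Y W = 0.
Proof. by case: hR => [[]]. Qed.

Lemma kahler_J34 X Y Z W : Rm X Y (J Z) (J W) = Rm X Y Z W.
Proof. by case: hR => _ <-. Qed.
Lemma kahler_J12 X Y Z W : Rm (J X) (J Y) Z W = Rm X Y Z W.
Proof. by rewrite curvature_pair kahler_J34 curvature_pair. Qed.

Lemma holomorphic_curvatureZ a X :
  Rm (a *: X) (J (a *: X)) (a *: X) (J (a *: X)) = a ^+ 4 * Rm X (J X) X (J X).
Proof.
rewrite linearZ (scalar_formZ (curvature_lin1 _ _ _)).
rewrite (scalar_formZ (curvature_lin2 _ _ _)) (scalar_formZ (curvature_lin3 _ _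
  _)).
rewrite (scalar_formZ (curvature_lin4 _ _ _)); ring.
Qed.

Lemma kahler_swap12 X Y Z W : Rm X (J Y) Z W = Rm Y (J X) Z W.
Proof.
rewrite -kahler_J12 JJ (scalar_formN (curvature_lin2 _ _ _)) curvature_anti12.
by rewrite opprK.
Qed.

Lemma kahler_swap34 X Y Z W : Rm X Y Z (J W) = Rm X Y W (J Z).
Proof. by rewrite curvature_pair kahler_swap12 curvature_pair. Qed.

(** The Bianchi identity for X, JX, Y against JY; invariance under J turns its other two terms into
    the negatives of those on the right. *)
Lemma kahler_mixed X Y :
  Rm X (J X) Y (J Y) = Rm X Y X Y + Rm X (J Y) X (J Y).
Proof.
have := curvature_bianchi X (J X) Y (J Y).
have -> : Rm (J X) Y X (J Y) = - Rm X (J Y) X (J Y).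
  by rewrite curvature_anti12 kahler_swap12.
have -> : Rm Y X (J X) (J Y) = - Rm X Y X Y.
  by rewrite kahler_J34 curvature_anti12.
lra.
Qed.

(** Polarising in slots 1 and 3, then in slots 2 and 4, shows that R is also skew in slots 2 and 4.
    Then the three terms of the Bianchi identity coincide. *)
Lemma sectional_zero_flat :
  (forall X Y, Rm X Y X Y = 0) -> forall X Y Z W, Rm X Y Z W = 0.
Proof.
move=> K0.
have K1 X Y Z : Rm X Y Z Y = 0.
  have := K0 (X + Z) Y.
  rewrite (scalar_formD (curvature_lin1 _ _ _)) !(scalar_formD (curvature_lin3
    _ _ _)).
  rewrite !K0 (curvature_pair Z Y X Y); lra.
have K2 X Y Z W : Rm X Y Z W = - Rm X W Z Y.
  have := K1 X (Y + W) Z.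
  rewrite (scalar_formD (curvature_lin2 _ _ _)) !(scalar_formD (curvature_lin4
    _ _ _)).
  rewrite !K1; lra.
move=> X Y Z W; have := curvature_bianchi X Y Z W.
have -> : Rm Y Z X W = Rm X Y Z W.
  by rewrite curvature_anti12 K2 opprK curvature_pair.
have -> : Rm Z X Y W = Rm X Y Z W.
  by rewrite curvature_anti12 K2 opprK curvature_anti34 -K2.
lra.
Qed.

(* Polarise the quartic form R(X, JX, X, JX) at X + Y and X - Y. *)
Lemma holomorphic_zero_flat :
  (forall X, Rm X (J X) X (J X) = 0) -> forall X Y Z W, Rm X Y Z W = 0.
Proof.
move=> H0; apply: sectional_zero_flat.
(* In the sum of the two expansions the terms of odd degree in Y cancel and the pure quartic ones
   vanish; those quadratic in both X and Y remain. *)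
have K3 X Y : 3 * Rm X (J Y) X (J Y) + Rm X Y X Y = 0.
  have := H0 (X - Y); have := H0 (X + Y).
  rewrite !linearD !linearN /=.
  rewrite !(scalar_formD (curvature_lin1 _ _ _)) !(scalar_formD (curvature_lin2
    _ _ _)).
  rewrite !(scalar_formD (curvature_lin3 _ _ _)) !(scalar_formD (curvature_lin4
    _ _ _)).
  rewrite !(scalar_formN (curvature_lin1 _ _ _)) !(scalar_formN (curvature_lin2
    _ _ _)).
  rewrite !(scalar_formN (curvature_lin3 _ _ _)) !(scalar_formN (curvature_lin4
    _ _ _)).
  rewrite !H0 (curvature_pair Y (J Y) X (J X)) kahler_mixed.
  rewrite !(kahler_swap12 Y X) !(kahler_swap34 _ _ Y X).
  lra.
(* Replacing Y by JY exchanges the two terms of [K3]; the resulting 2 by 2 system is nonsingular. *)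
move=> X Y; have := K3 X Y; have := K3 X (J Y).
rewrite JJ (scalar_formN (curvature_lin2 _ _ _)) (scalar_formN (curvature_lin4
  _ _ _)).
lra.
Qed.

End KahlerIdentities.

(** * Projections onto traceless symmetric and anti-invariant tensors *)

Section FrobeniusProduct.
Variables (R : realType) (n : nat).
Implicit Types (A B C : 'M[R]_n).

Definition frob A B : R := \tr (A^T *m B).

Lemma frobE A B : frob A B = \sum_i \sum_j A i j * B i j.
Proof.
rewrite /frob /mxtrace exchange_big; apply: eq_bigr => j _.
by rewrite mxE; apply: eq_bigr => i _; rewrite mxE.
Qed.

Lemma frob_inner : inner_product (frob : 'M[R]_n -> 'M[R]_n -> R).
Proof.
split=> [B a A C|A B|A A0].
- by rewrite /frob linearP /= mulmxDl -scalemxAl linearP.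
- by rewrite /frob -mxtrace_tr trmx_mul trmxK.
have [i [j Aij]] : exists i, exists j, A i j != 0.
  have /rV0Pn[] : mxvec A != 0.
    by apply: contraNneq A0 => h; rewrite -(mxvecK A) h linear0.
  by move=> k; case/mxvec_indexP: k => i j; rewrite mxvecE => ?; exists i, j.
rewrite frobE (bigD1 i) //= (bigD1 j) //= -addrA.
apply: ltr_pwDl; first by rewrite -expr2 exprn_even_gt0.
apply: addr_ge0; apply: sumr_ge0 => k _; first by rewrite -expr2 sqr_ge0.
by apply: sumr_ge0 => l _; rewrite -expr2 sqr_ge0.
Qed.

Lemma frob_delta A j k : frob A (delta_mx j k) = A j k.
Proof.
rewrite frobE (bigD1 j) //= (bigD1 k) //= mxE !eqxx mulr1.
rewrite big1 => [|l lk]; last by rewrite mxE (negbTE lk) andbF mulr0.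
rewrite big1 => [|i ij]; first by rewrite !addr0.
by rewrite big1 // => l _; rewrite mxE (negbTE ij) mulr0.
Qed.

Section Projection.
Variables (U : {vspace 'M[R]_n}) (s : seq 'M[R]_n) (p : 'M[R]_n -> 'M[R]_n).
Hypotheses (os : orthonormal_seq frob s) (bs : basis_of U s).
Hypothesis pU : forall A, p A \in U.
Hypothesis pO : forall A B, B \in U -> frob B (A - p A) = 0.

(** The sum of A tensor A over an orthonormal basis of [U] is the kernel of the projection [p], here
    read off at an elementary matrix. *)
Lemma sum_orthonormal_entries i j k l :
  \sum_(A <- s) A i l * A j k = p (delta_mx j k) i l.
Proof.
rewrite -(orthonormal_seq_proj frob_inner os bs (pU _) (@pO (delta_mx j k))).
rewrite summxE; apply: eq_bigr => A _.
by rewrite mxE frob_delta mulrC.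
Qed.

(** The rank of a projection is its trace. *)
Lemma size_orthonormal_basis :
  (size s)%:R = \sum_i \sum_l p (delta_mx i l) i l.
Proof.
under [RHS]eq_bigr => i _ do under eq_bigr => l _ do
  rewrite -sum_orthonormal_entries.
under [RHS]eq_bigr => i _ do rewrite exchange_big.
rewrite exchange_big -sum1_size natr_sum; apply: eq_big_seq => A As.
by rewrite -frobE; case: os => _ ->; rewrite ?eqxx.
Qed.

End Projection.

Definition proj_S20 A : 'M[R]_n :=
  2^-1 *: (A + A^T) - (\tr A / n%:R)%:M.

Lemma proj_S20_mem A : (0 < n)%N -> proj_S20 A \in S20 R n.
Proof.
move=> n0; rewrite memS20; apply/andP; split; apply/eqP.
  by rewrite linearB linearZ linearD /= trmxK tr_scalar_mx (addrC A^T).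
rewrite linearB linearZ linearD /= mxtrace_tr mxtrace_scalar -[X in _ -
  X]mulr_natr.
by rewrite divfK ?pnatr_eq0 -?lt0n //; field.
Qed.

Lemma proj_S20_ortho A B : B \in S20 R n -> frob B (A - proj_S20 A) = 0.
Proof.
rewrite memS20 => /andP[/eqP Bs /eqP B0].
rewrite /frob Bs /proj_S20 opprB addrCA mulmxDr linearD /=.
rewrite mul_mx_scalar linearZ /= B0 mulr0 add0r mulmxBr linearB /=.
rewrite -scalemxAr linearZ mulmxDr linearD /=.
have -> : \tr (B *m A^T) = \tr (B *m A).
  by rewrite -mxtrace_tr trmx_mul trmxK Bs mxtrace_mulC.
by field.
Qed.

Lemma proj_S20_delta i j k l : proj_S20 (delta_mx j k) i l =
  2^-1 * ((i == j)%:R * (k == l)%:R + (i == k)%:R * (j == l)%:R)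
  - (i == l)%:R * (j == k)%:R / n%:R.
Proof.
rewrite /proj_S20.
have -> : \tr (delta_mx j k : 'M[R]_n) = (j == k)%:R.
  rewrite /mxtrace (bigD1 j) //= mxE eqxx big1 ?addr0 //= => i' ij.
  by rewrite mxE (negbTE ij).
rewrite !mxE -!mulnb !natrM !(eq_sym l) (eq_sym i j).
by rewrite -[X in _ - X]mulr_natl mulrA (mulrC (j == l)%:R).
Qed.

Variable Jm : 'M[R]_n.
Hypothesis Jskew : Jm^T = - Jm.
Hypothesis Jsq : Jm *m Jm = - 1%:M.

(* Since Jm^2 = -1, the condition Jm A Jm = A says that A anti-commutes with
   Jm. *)
Definition antiS2 : {vspace 'M[R]_n} :=
  (lker (linfun (idfun \- trmx : 'M[R]_n -> 'M[R]_n)) :&: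
   lker (linfun (idfun \- (mulmxr Jm \o mulmx Jm) : 'M[R]_n -> 'M[R]_n)))%VS.

Lemma mem_antiS2 A : (A \in antiS2) = (A^T == A) && (Jm *m A *m Jm == A).
Proof.
by rewrite memv_cap !memv_ker !lfunE /= !subr_eq0 eq_sym; congr (_ && _);
  rewrite eq_sym.
Qed.

(** Anti-invariance forces trace zero: the trace of Jm A Jm is that of Jm^2 A = - A. *)
Lemma antiS2_sub_S20 : (antiS2 <= S20 R n)%VS.
Proof.
apply/subvP => A; rewrite mem_antiS2 memS20 => /andP[-> /eqP JAJ] /=.
have : \tr A = - \tr A.
  by rewrite -[in LHS]JAJ mxtrace_mulC mulmxA Jsq mulNmx mul1mx linearN.
by move=> h; apply/eqP; lra.
Qed.

(** Symmetrisation followed by averaging over the involution sending A to Jm A Jm. *)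
Definition proj_antiS2 A : 'M[R]_n :=
  4^-1 *: ((A + A^T) + Jm *m (A + A^T) *m Jm).

Lemma proj_antiS2_mem A : proj_antiS2 A \in antiS2.
Proof.
rewrite mem_antiS2 /proj_antiS2; set B := A + A^T.
have BT : B^T = B by rewrite /B linearD /= trmxK addrC.
apply/andP; split; apply/eqP.
  rewrite linearZ linearD /= !trmx_mul BT Jskew.
  by rewrite !(mulNmx, mulmxN) opprK mulmxA.
rewrite -scalemxAr -scalemxAl; congr (_ *: _).
rewrite mulmxDr mulmxDl addrC; congr (_ + _).
rewrite !mulmxA Jsq -!mulmxA Jsq mulNmx mul1mx.
by rewrite mulmxN mulmx1 opprK.
Qed.

Lemma proj_antiS2_ortho A B : B \in antiS2 ->
  frob B (A - proj_antiS2 A) = 0.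
Proof.
rewrite mem_antiS2 => /andP[/eqP Bs /eqP JBJ].
have trT C : \tr (B *m C^T) = \tr (B *m C).
  by rewrite -mxtrace_tr trmx_mul trmxK Bs mxtrace_mulC.
have trJ C : \tr (B *m (Jm *m C *m Jm)) = \tr (B *m C).
  by rewrite !mulmxA mxtrace_mulC !mulmxA JBJ.
rewrite /frob Bs /proj_antiS2 mulmxBr linearB -scalemxAr linearZ /=.
rewrite mulmxDr linearD /= trJ mulmxDr linearD /= trT.
by field.
Qed.

Lemma proj_antiS2_delta i j k l : proj_antiS2 (delta_mx j k) i l =
  4^-1 * ((i == j)%:R * (k == l)%:R + (i == k)%:R * (j == l)%:R
          + Jm i j * Jm k l + Jm i k * Jm j l).
Proof.
have JdJ a b : (Jm *m delta_mx a b *m Jm) i l = Jm i a * Jm b l.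
  rewrite mxE (bigD1 b) //= big1 ?addr0 => [|c cb].
    rewrite mxE (bigD1 a) //= big1 ?addr0 => [|c ca].
      by rewrite mxE !eqxx mulr1.
    by rewrite mxE (negbTE ca) mulr0.
  by rewrite mxE big1 ?mul0r // => d _; rewrite mxE (negbTE cb) andbF mulr0.
rewrite /proj_antiS2 trmx_delta mulmxDr mulmxDl mxE [X in _ * X]mxE.
by rewrite [X in _ + X]mxE !JdJ !mxE -!mulnb !natrM !(eq_sym l) addrA.
Qed.

End FrobeniusProduct.

Lemma sum_delta_const (R : realType) (n : nat) (a b : R) :
  \sum_(i < n) \sum_(l < n) (a + b * (i == l)%:R) = n%:R ^+ 2 * a + n%:R * b.
Proof.
have -> : \sum_(i < n) \sum_(l < n) (a + b * (i == l)%:R) =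
    \sum_(i < n) (n%:R * a + b).
  apply: eq_bigr => i _; rewrite big_split /= sumr_const card_ord mulr_natl.
  rewrite -mulr_sumr (bigD1 i) //= eqxx big1 ?addr0 ?mulr1 // => l li.
  by rewrite eq_sym (negbTE li).
by rewrite sumr_const card_ord -mulr_natl; ring.
Qed.

(** * Traces of the form of the second kind as contractions of R *)

Section Contraction.
Variables (R : realType) (n : nat) (V : vectType R).
Variables (g : {dot V for idfun}) (J : 'End(V)).
Variables (Rm : V -> V -> V -> V -> R) (e : n.-tuple V).
Hypothesis JJ : forall X, J (J X) = - X.
Hypothesis gJ : forall X Y, g (J X) (J Y) = g X Y.
Hypothesis hR : kahler_curvature J Rm.
Hypothesis he : orthonormal_basis g e.

Local Notation E := (tnth e).

Lemma dot_inner : inner_product (g : V -> V -> R).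
Proof.
split=> [y a x z|x y|x x0].
- by rewrite linearPl.
- by have := hermC g x y; rewrite expr0 mul1r.
- exact: neq0_dnorm_gt0.
Qed.

Lemma orthonormal_basis_seq : orthonormal_seq g e.
Proof.
case: he => [be oe]; have ue := free_uniq (basis_free be); split=> //.
by move=> _ _ /tnthP[i ->] /tnthP[j ->]; rewrite oe (inj_eq (tuple_uniqP _ ue)).
Qed.

Lemma coord_expand X : \sum_i g (E i) X *: E i = X.
Proof.
case: he => [be _].
rewrite -(big_tuple _ _ e xpredT (fun x => g x X *: x)).
by apply: (orthonormal_seq_expand dot_inner orthonormal_basis_seq);
  rewrite (span_basis be) memvf.
Qed.

(** Parseval's identity twisted by [f]; it is applied with the identity and with [J]. *)
Lemma coord_pair (f : {linear V -> V}) X Y :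
  \sum_p g X (f (E p)) * g Y (E p) = g X (f Y).
Proof.
rewrite -[in RHS](coord_expand Y) linear_sum /=.
under [in RHS]eq_bigr => p _ do rewrite linearZ /=.
rewrite (scalar_form_sum (inner_linr dot_inner X)).
by apply: eq_bigr => p _; rewrite mulrC (inner_sym dot_inner Y).
Qed.

Definition Jmx : 'M[R]_n := \matrix_(i, j) g (E i) (J (E j)).

Lemma dot_Jr X Y : g X (J Y) = - g (J X) Y.
Proof. by rewrite -gJ JJ (scalar_formN (inner_linr dot_inner _)). Qed.

Lemma Jmx_skew : Jmx^T = - Jmx.
Proof.
by apply/matrixP => i j; rewrite !mxE dot_Jr (inner_sym dot_inner).
Qed.

Lemma Jmx_sq : Jmx *m Jmx = - 1%:M.
Proof.
apply/matrixP => i j; rewrite !mxE.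
under eq_bigr => k _ do rewrite !mxE (inner_sym dot_inner (E k)).
rewrite coord_pair /= JJ (scalar_formN (inner_linr dot_inner _)).
by case: he => _ ->.
Qed.

Definition contract (T : 'I_n -> 'I_n -> 'I_n -> 'I_n -> R) : R :=
  \sum_i \sum_j \sum_k \sum_l Rm (E i) (E j) (E k) (E l) * T i j k l.

Lemma eq_contract T T' : (forall i j k l, T i j k l = T' i j k l) ->
  contract T = contract T'.
Proof.
move=> TT; do 4 (apply: eq_bigr => ? _); by rewrite TT.
Qed.

Lemma contractD T T' :
  contract (fun i j k l => T i j k l + T' i j k l) = contract T + contract T'.
Proof.
rewrite /contract -big_split; apply: eq_bigr => i _.
rewrite -big_split; apply: eq_bigr => j _.
rewrite -big_split; apply: eq_bigr => k _.
by rewrite -big_split; apply: eq_bigr => l _; rewrite mulrDr.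
Qed.

Lemma contractZ a T : contract (fun i j k l => a * T i j k l) = a * contract T.
Proof.
rewrite /contract; do 4 (rewrite mulr_sumr; apply: eq_bigr => ? _); ring.
Qed.

Lemma contract_sum (I : Type) (r : seq I) T :
  contract (fun i j k l => \sum_(a <- r) T a i j k l) =
  \sum_(a <- r) contract (T a).
Proof.
elim: r => [|a r IH].
  rewrite big_nil -[RHS](mul0r (contract (fun _ _ _ _ => 0))) -contractZ.
  by apply: eq_contract => *; rewrite big_nil mul0r.
rewrite big_cons -IH -contractD.
by apply: eq_contract => *; rewrite big_cons.
Qed.

Lemma contract_vectors X Y Z W :
  contract (fun i j k l => g (E i) X * g (E j) Y * g (E k) Z * g (E l) W) =
  Rm X Y Z W.
Proof.
rewrite -[in RHS](coord_expand X) (scalar_form_sum (curvature_lin1 hR _ _ _)).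
apply: eq_bigr => i _.
rewrite -[in RHS](coord_expand Y) (scalar_form_sum (curvature_lin2 hR _ _ _)).
rewrite mulr_sumr; apply: eq_bigr => j _.
rewrite -[in RHS](coord_expand Z) (scalar_form_sum (curvature_lin3 hR _ _ _)).
rewrite !mulr_sumr; apply: eq_bigr => k _.
rewrite -[in RHS](coord_expand W) (scalar_form_sum (curvature_lin4 hR _ _ _)).
rewrite !mulr_sumr; apply: eq_bigr => l _.
ring.
Qed.

(** Kronecker deltas and entries of [Jmx] are themselves sums over the frame; expanding them turns a
    contraction into a double trace of R. *)
Lemma contract_frames (X Y Z W : 'I_n -> 'I_n -> V) T :
  (forall i j k l, T i j k l =
    \sum_p \sum_q g (E i) (X p q) * g (E j) (Y p q) * g (E k) (Z p q)
                  * g (E l) (W p q)) ->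
  contract T = \sum_p \sum_q Rm (X p q) (Y p q) (Z p q) (W p q).
Proof.
move=> TE; rewrite (eq_contract TE) contract_sum; apply: eq_bigr => p _.
rewrite contract_sum; apply: eq_bigr => q _; exact: contract_vectors.
Qed.

(** The scalar curvature, in the convention where R(X, Y, X, Y) is sectional. *)
Definition scal : R := \sum_p \sum_q Rm (E p) (E q) (E p) (E q).

Lemma coord_delta i j : \sum_p g (E i) (E p) * g (E j) (E p) = (i == j)%:R.
Proof. by rewrite (coord_pair idfun) /=; case: he. Qed.

Lemma coord_Jmx i j : \sum_p g (E i) (J (E p)) * g (E j) (E p) = Jmx i j.
Proof. by rewrite coord_pair mxE. Qed.

Lemma coord_JJ i j :
  \sum_p g (E i) (J (E p)) * g (E j) (J (E p)) = (i == j)%:R.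
Proof.
under eq_bigr => p _ do rewrite !dot_Jr mulrNN.
by rewrite (coord_pair idfun) /= gJ; case: he.
Qed.

Lemma contract_12_34 : contract (fun i j k l => (i == j)%:R * (k == l)%:R) = 0.
Proof.
rewrite (@contract_frames (fun p _ => E p) (fun p _ => E p)
  (fun _ q => E q) (fun _ q => E q)) => [|i j k l].
  rewrite big1 // => p _; rewrite big1 // => q _.
  by have := curvature_anti12 hR (E p) (E p) (E q) (E q); lra.
rewrite -!coord_delta big_distrlr; do 2 (apply: eq_bigr => ? _); rewrite /=;
  ring.
Qed.

Lemma contract_13_24 :
  contract (fun i j k l => (i == k)%:R * (j == l)%:R) = scal.
Proof.
apply: (@contract_frames (fun p _ => E p) (fun _ q => E q)
  (fun p _ => E p) (fun _ q => E q)) => i j k l.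
rewrite -!coord_delta big_distrlr; do 2 (apply: eq_bigr => ? _); rewrite /=;
  ring.
Qed.

Lemma contract_14_23 :
  contract (fun i j k l => (i == l)%:R * (j == k)%:R) = - scal.
Proof.
rewrite (@contract_frames (fun p _ => E p) (fun _ q => E q)
  (fun _ q => E q) (fun p _ => E p)) => [|i j k l].
  rewrite /scal -sumrN; apply: eq_bigr => p _; rewrite -sumrN.
  by apply: eq_bigr => q _; exact: (curvature_anti34 hR).
rewrite -!coord_delta big_distrlr; do 2 (apply: eq_bigr => ? _); rewrite /=;
  ring.
Qed.

Lemma contract_J13_J24 :
  contract (fun i j k l => Jmx i k * Jmx j l) = scal.
Proof.
rewrite (@contract_frames (fun p _ => J (E p)) (fun _ q => J (E q))
  (fun p _ => E p) (fun _ q => E q)) => [|i j k l].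
  by do 2 (apply: eq_bigr => ? _); exact: (kahler_J12 hR).
rewrite -!coord_Jmx big_distrlr; do 2 (apply: eq_bigr => ? _); rewrite /=; ring.
Qed.

(** The vectors J (E q) form another orthonormal basis. *)
Lemma scal_J : \sum_p \sum_q Rm (E p) (J (E q)) (E p) (J (E q)) = scal.
Proof.
rewrite -contract_13_24; apply/esym.
apply: (@contract_frames (fun p _ => E p) (fun _ q => J (E q))
  (fun p _ => E p) (fun _ q => J (E q))) => i j k l.
rewrite -coord_delta -coord_JJ big_distrlr; do 2 (apply: eq_bigr => ? _);
  rewrite /=; ring.
Qed.

(** By [kahler_mixed] the double trace splits into [scal] and the sum of [scal_J]. *)
Lemma contract_J12_J34 :
  contract (fun i j k l => Jmx i j * Jmx k l) = 2 * scal.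
Proof.
rewrite (@contract_frames (fun p _ => J (E p)) (fun p _ => E p)
  (fun _ q => J (E q)) (fun _ q => E q)) => [|i j k l].
  rewrite mulr2n mulrDl mul1r -{2}scal_J /scal -big_split;
    apply: eq_bigr => p _.
  rewrite -big_split; apply: eq_bigr => q _ /=.
  by rewrite (curvature_anti12 hR) (curvature_anti34 hR) opprK (kahler_mixed JJ
    hR).
rewrite -!coord_Jmx big_distrlr; do 2 (apply: eq_bigr => ? _); rewrite /=; ring.
Qed.

Local Notation csk := (curvature_second_kind Rm e).

Lemma csk_contract A B :
  csk A B = contract (fun i j k l => A i l * B j k).
Proof. by do 4 (apply: eq_bigr => ? _); rewrite mulrA. Qed.

(** In the projection kernel the symmetrised part contributes scal / 2, the trace correction scal /
    n. *)
Lemma trace_S20 s : (0 < n)%N -> orthonormal_seq (@frob R n) s ->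
  basis_of (S20 R n) s ->
  \sum_(A <- s) csk A A = (2^-1 + n%:R^-1) * scal.
Proof.
move=> n0 os bs; under eq_bigr do rewrite csk_contract.
rewrite -contract_sum.
rewrite (@eq_contract _ (fun i j k l =>
   (2^-1 * ((i == j)%:R * (k == l)%:R) + 2^-1 * ((i == k)%:R * (j == l)%:R))
   + (- n%:R^-1) * ((i == l)%:R * (j == k)%:R))).
  rewrite !contractD !contractZ contract_12_34 contract_13_24 contract_14_23;
    ring.
move=> i j k l; rewrite (sum_orthonormal_entries os bs (fun A => proj_S20_mem A
  n0)
  (@proj_S20_ortho R n)) proj_S20_delta; ring.
Qed.

Lemma size_S20 s : (0 < n)%N -> orthonormal_seq (@frob R n) s ->
  basis_of (S20 R n) s -> (size s)%:R = (n%:R ^+ 2 + n%:R) / 2 - 1 :> R.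
Proof.
move=> n0 os bs; rewrite (size_orthonormal_basis os bs (fun A => proj_S20_mem A
  n0)
  (@proj_S20_ortho R n)).
have nn : n%:R != 0 :> R by rewrite pnatr_eq0 -lt0n.
rewrite (_ : \sum_i _ = \sum_(i < n) \sum_(l < n)
   (2^-1 + (2^-1 - n%:R^-1) * (i == l)%:R)); first by rewrite sum_delta_const;
     field.
apply: eq_bigr => i _; apply: eq_bigr => l _; rewrite proj_S20_delta !eqxx.
by case: eqP => _ /=; ring.
Qed.

(** The four terms of the projection kernel contribute 0, [scal], 2 [scal] and [scal], which the
    factor 1/4 averages to [scal]. *)
Lemma trace_antiS2 s : orthonormal_seq (@frob R n) s ->
  basis_of (antiS2 Jmx) s -> \sum_(A <- s) csk A A = scal.
Proof.
move=> os bs; under eq_bigr do rewrite csk_contract.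
rewrite -contract_sum.
rewrite (@eq_contract _ (fun i j k l => 4^-1 *
   ((i == j)%:R * (k == l)%:R + (i == k)%:R * (j == l)%:R
    + Jmx i j * Jmx k l + Jmx i k * Jmx j l))).
  rewrite contractZ !contractD contract_12_34 contract_13_24 contract_J12_J34.
  by rewrite contract_J13_J24; field.
move=> i j k l.
rewrite (sum_orthonormal_entries os bs (proj_antiS2_mem Jmx_skew Jmx_sq)
  (@proj_antiS2_ortho R n Jmx)).
exact: proj_antiS2_delta.
Qed.

(** The trace of the projection, where [Jmx] has zero diagonal and squared norm n. For n = 2m the
    value is m^2 + m. *)
Lemma size_antiS2 s : orthonormal_seq (@frob R n) s ->
  basis_of (antiS2 Jmx) s -> (size s)%:R = (n%:R ^+ 2 + 2 * n%:R) / 4 :> R.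
Proof.
move=> os bs.
rewrite (size_orthonormal_basis os bs (proj_antiS2_mem Jmx_skew Jmx_sq)
  (@proj_antiS2_ortho R n Jmx)).
have J0 i : Jmx i i = 0.
  by have /matrixP/(_ i i) := Jmx_skew; rewrite !mxE; lra.
have JF : \sum_i \sum_j Jmx i j * Jmx i j = n%:R.
  by rewrite -frobE /frob Jmx_skew mulNmx Jmx_sq opprK mxtrace1.
rewrite (_ : \sum_i _ = \sum_(i < n) \sum_(l < n) (4^-1 + 4^-1 * (i == l)%:R)
   + 4^-1 * \sum_i \sum_j Jmx i j * Jmx i j).
  by rewrite sum_delta_const JF; field.
rewrite mulr_sumr -big_split; apply: eq_bigr => i _ /=.
rewrite mulr_sumr -big_split; apply: eq_bigr => l _ /=.
by rewrite proj_antiS2_delta !eqxx !J0; case: eqP => _ /=; ring.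
Qed.

End Contraction.

(** * Holomorphic sectional curvature as a value of the form *)

Section HolomorphicTensor.
Variables (R : realType) (n : nat) (V : vectType R).
Variables (g : {dot V for idfun}) (J : 'End(V)).
Variables (Rm : V -> V -> V -> V -> R) (e : n.-tuple V).
Hypothesis JJ : forall X, J (J X) = - X.
Hypothesis gJ : forall X Y, g (J X) (J Y) = g X Y.
Hypothesis hR : kahler_curvature J Rm.
Hypothesis he : orthonormal_basis g e.

Local Notation E := (tnth e).
Local Notation Jm := (Jmx g J e).

Definition coordv X : 'cV[R]_n := \col_i g (E i) X.

Lemma Jmx_coordv X : Jm *m coordv X = coordv (J X).
Proof.
apply/matrixP => i j; rewrite !mxE -(coord_pair he J).
by apply: eq_bigr => k _; rewrite !mxE (inner_sym (dot_inner g) X).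
Qed.

Lemma coordvN X : coordv (- X) = - coordv X.
Proof.
by apply/matrixP => i j;
  rewrite !mxE (scalar_formN (inner_linr (dot_inner g) _)).
Qed.

Definition holo_tensor X : 'M[R]_n := (Num.sqrt 2)^-1 *:
  (coordv X *m (coordv X)^T - coordv (J X) *m (coordv (J X))^T).

Lemma holo_tensor_anti X : holo_tensor X \in antiS2 Jm.
Proof.
have Jt Y : (coordv Y)^T *m Jm = - (coordv (J Y))^T.
  rewrite -Jmx_coordv trmx_mul (Jmx_skew e JJ gJ) mulmxN opprK //.
have Jo Y : Jm *m (coordv Y *m (coordv Y)^T) *m Jm =
    - (coordv (J Y) *m (coordv (J Y))^T).
  by rewrite mulmxA Jmx_coordv -mulmxA Jt mulmxN.
rewrite mem_antiS2; apply/andP; split; apply/eqP.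
  by rewrite /holo_tensor linearZ linearB /= !trmx_mul !trmxK.
rewrite /holo_tensor -scalemxAr -scalemxAl mulmxBr mulmxBl !Jo JJ coordvN.
by rewrite [(- _)^T]linearN /= mulNmx mulmxN !opprK addrC.
Qed.

Lemma frob_outer X Y : frob (coordv X *m (coordv X)^T) (coordv Y *m (coordv
  Y)^T)
  = g X Y ^+ 2.
Proof.
rewrite frobE -[g X Y](coord_pair he idfun X Y) expr2 big_distrlr /=.
apply: eq_bigr => i _; apply: eq_bigr => l _.
rewrite !mxE !big_ord1 !mxE !(inner_sym (dot_inner g) _ (E _)); ring.
Qed.

Lemma sqrt2_inv : (Num.sqrt 2)^-1 * (Num.sqrt 2)^-1 = 2^-1 :> R.
Proof. by rewrite -expr2 exprVn sqr_sqrtr. Qed.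

Lemma holo_tensor_unit X : g X X = 1 -> frob (holo_tensor X) (holo_tensor X) =
  1.
Proof.
move=> gX; have fI := @frob_inner R n.
have gXJ : g X (J X) = 0.
  by have := dot_Jr JJ gJ X X; rewrite (inner_sym (dot_inner g) (J X)); lra.
rewrite /holo_tensor (scalar_formZ (inner_linl fI _)) (scalar_formZ (inner_linr
  fI _)).
rewrite mulrA sqrt2_inv (scalar_formD (inner_linl fI _)) (scalar_formN
  (inner_linl fI _)).
rewrite !(scalar_formD (inner_linr fI _)) !(scalar_formN (inner_linr fI _))
  !frob_outer.
by rewrite gJ gX gXJ (inner_sym (dot_inner g) (J X)) gXJ; field.
Qed.

(** Of the four products, the two pure ones vanish by skew symmetry, and each mixed one gives the
    holomorphic sectional curvature, halved by the normalisation. *)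
Lemma holo_tensor_curvature X :
  curvature_second_kind Rm e (holo_tensor X) (holo_tensor X) =
  Rm X (J X) X (J X).
Proof.
rewrite csk_contract.
pose T := fun (X1 X2 X3 X4 : V) (i j k l : 'I_n) =>
  g (E i) X1 * g (E j) X2 * g (E k) X3 * g (E l) X4.
rewrite (@eq_contract _ _ _ _ _ _
  (fun i j k l => 2^-1 * (T X X X X i j k l +
   (-1) * T X (J X) (J X) X i j k l + (-1) * T (J X) X X (J X) i j k l +
   T (J X) (J X) (J X) (J X) i j k l))); last first.
  by move=> i j k l; rewrite !mxE !big_ord1 !mxE /T -sqrt2_inv; ring.
rewrite contractZ !contractD !contractZ !(contract_vectors hR he).
have a12 Y Z W : Rm Y Y Z W = 0 by have := curvature_anti12 hR Y Y Z W; lra.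
rewrite !a12 (curvature_anti34 hR X (J X) (J X)) (curvature_anti12 hR (J X) X).
by field.
Qed.

End HolomorphicTensor.

(** * From alpha-nonnegativity to weighted sums on an adapted basis *)

Section WeightedInequality.
Variables (R : realType) (m : nat) (V : vectType R).
Variables (g : {dot V for idfun}) (J : 'End(V)).
Variables (Rm : V -> V -> V -> V -> R) (e : (2 * m).-tuple V).
Hypothesis m0 : (0 < m)%N.
Hypothesis JJ : forall X, J (J X) = - X.
Hypothesis gJ : forall X Y, g (J X) (J Y) = g X Y.
Hypothesis hR : kahler_curvature J Rm.
Hypothesis he : orthonormal_basis g e.

Lemma natr_dimS20 : (dimS20 (2 * m))%:R = 2 * m%:R ^+ 2 + m%:R - 1 :> R.
Proof.
rewrite /dimS20.
have -> : ((2 * m).-1 * (2 * m).+2)%N = ((2 * m).-1 * m.+1).*2.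
  by rewrite -muln2 -mulnA; congr (_ * _)%N; lia.
rewrite doubleK natrM -subn1 natrB; last by lia.
by rewrite natrM -natr1; ring.
Qed.

(* The weight is q on the J-invariant part of the basis, r' on the tensor of X
   and r on the rest of the J-anti-invariant part. *)
Lemma weighted_curvature_ge0 (alpha q r r' : R) X :
  alpha_nonnegative (2 * m) g Rm alpha -> 0 <= alpha < (dimS20 (2 * m))%:R ->
  g X X = 1 -> 0 <= q <= 1 -> 0 <= r <= 1 -> 0 <= r' <= 1 ->
  q * (m%:R ^+ 2 - 1) + r * (m%:R ^+ 2 + m%:R - 1) + r' = alpha ->
  0 <= q * (- ((m%:R - 1) / (2 * m%:R)) * scal Rm e)
       + r * (scal Rm e - Rm X (J X) X (J X)) + r' * Rm X (J X) X (J X).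
Proof.
move=> hA /andP[a0 aN] gX q01 r01 r'01 wa.
have n0 : (0 < 2 * m)%N by rewrite muln_gt0.
have mR : m%:R != 0 :> R by rewrite pnatr_eq0 -lt0n.
have fI := @frob_inner R (2 * m).
set phi := holo_tensor g J e X.
have phiA : phi \in antiS2 (Jmx g J e) by apply: holo_tensor_anti.
have o1 : orthonormal_seq (@frob R (2 * m)) [:: phi].
  split=> // A B; rewrite !inE => /eqP-> /eqP->.
  by rewrite eqxx (holo_tensor_unit JJ gJ he).
(* The basis is built in two stages: [phi :: t] spans the anti-invariant part, and [u] then spans
   its orthogonal complement, the J-invariant part. *)
have [|t [ot bt]] := orthonormal_seq_extend fI o1 (U := antiS2 (Jmx g J e)).
  by move=> A; rewrite inE => /eqP->.
rewrite cat1s in ot bt.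
have [|u [ou bu]] := orthonormal_seq_extend fI ot (U := S20 R (2 * m)).
  move=> A At; apply: (subvP (antiS2_sub_S20 (Jmx_sq JJ he))).
  exact: (basis_mem bt At).
pose F A := curvature_second_kind Rm e A A.
(* The hypothesis holds for every ordering of the basis; the increasing one gives the strongest
   bound. *)
pose s := sort (fun A B => F A <= F B) ((phi :: t) ++ u).
have ps : perm_eq ((phi :: t) ++ u) s by rewrite perm_sym perm_sort.
have os := orthonormal_seq_perm ps ou.
have bs : basis_of (S20 R (2 * m)) s by rewrite -(perm_basis _ ps).
have sR : (size s)%:R = (dimS20 (2 * m))%:R :> R.
  by rewrite (size_S20 n0 os bs) natr_dimS20 natrM; field.
have sN : size s == dimS20 (2 * m) by rewrite -(eqr_nat R) sR.
have sF : sorted (fun A B => F A <= F B) s.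
  by apply: sort_sorted => A B; apply: le_total.
pose w A := if A == phi then r' else if A \in t then r else q.
have [uu _] := ou.
have Fphi : F phi = Rm X (J X) X (J X) by apply: holo_tensor_curvature.
have sumE (G : 'M[R]_(2 * m) -> R) : \sum_(A <- s) w A * G A =
    r' * G phi + r * (\sum_(A <- t) G A) + q * \sum_(A <- u) G A.
  rewrite -(perm_big _ ps) big_cat big_cons /= {1}/w eqxx !mulr_sumr.
  move: uu; rewrite cat_uniq cons_uniq => /and3P[/andP[pt _] /hasPn hu _].
  congr (_ + _ + _); apply: eq_big_seq => A At; congr (_ * _); rewrite /w.
    by rewrite At; case: eqP pt => // <-; rewrite At.
  by have := hu _ At; rewrite /= inE negb_or => /andP[/negbTE-> /negbTE->].
have trt : \sum_(A <- t) F A = scal Rm e - F phi.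
  by have := trace_antiS2 JJ gJ hR he ot bt; rewrite big_cons /F => <-; ring.
(* The trace on [u] is the difference of the two known traces, 1/2 + 1/(2m) - 1 times [scal]. *)
have tru : \sum_(A <- u) F A = - ((m%:R - 1) / (2 * m%:R)) * scal Rm e.
  have := trace_S20 hR he n0 ou bu.
  rewrite big_cat (trace_antiS2 JJ gJ hR he ot bt) /= natrM => h.
  by rewrite /F (canRL (addKr _) h); field.
have st : (size t)%:R = m%:R ^+ 2 + m%:R - 1 :> R.
  have := size_antiS2 JJ gJ he ot bt; rewrite /= -natr1 natrM => h.
  by rewrite -[LHS](addrK 1) h; field.
have su : (size u)%:R = m%:R ^+ 2 - 1 :> R.
  have := sR; rewrite -(perm_size ps) size_cat natrD natr_dimS20.
  by rewrite /= -natr1 st => h; lra.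
rewrite -Fphi -trt -tru.
suff : 0 <= \sum_(A <- s) w A * F A by rewrite sumE; lra.
have on : S20_orthonormal_basis (Tuple sN).
  split=> // i j; rewrite !(tnth_nth 0) /= -[LHS]/(frob _ _).
  by rewrite (orthonormal_seq_nth os) ?(eqP sN).
have {}hA := hA e (Tuple sN) he on;
  apply: (sorted_weighted_sum_ge0 sF _ _ _ hA).
(* Strictness of alpha < [dimS20] keeps the index of the fractional term inside the basis. *)
- by rewrite (eqP sN) truncn_lt_nat.
- by move=> A _; rewrite /w; case: ifP => // _; case: ifP.
(* The total mass is [sumE] at the constant 1. *)
have := sumE (fun=> 1); under eq_bigr do rewrite mulr1; move=> ->.
by rewrite !big_const_seq !count_predT !iter_addr_0 st su -wa; ring.
Qed.

End WeightedInequality.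

(** * Existence of a frame and reversal of the sign of R *)

Lemma orthonormal_basis_exists (R : realType) (V : vectType R)
    (g : {dot V for idfun}) n :
  \dim {:V} = n -> exists e : n.-tuple V, orthonormal_basis g e.
Proof.
move=> dn; have [|//|s []] := orthonormal_seq_extend (dot_inner g)
  (s := [::]) (U := fullv); first by split.
rewrite cat0s => os bs; have sn : size s == n.
  by rewrite -dn -(span_basis bs) eq_sym; apply: basis_free bs.
exists (Tuple sn); split=> // i j; rewrite !(tnth_nth 0) /=.
by rewrite (orthonormal_seq_nth os) ?(eqP sn).
Qed.

(** Reduces the nonpositive case for R to the nonnegative case for - R. *)
Lemma kahler_curvatureN (R : realType) (V : vectType R) (J : 'End(V))
    (Rm : V -> V -> V -> V -> R) :
  kahler_curvature J Rm -> kahler_curvature J (fun X Y Z W => - Rm X Y Z W).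
Proof.
move=> hR; have hK := kahler_J34 hR.
case: hR => [[[h1 h2 h3 h4] a12 a34 pr bi] _]; do !split.
- by move=> Y Z W a u v; rewrite h1; ring.
- by move=> X Z W a u v; rewrite h2; ring.
- by move=> X Y W a u v; rewrite h3; ring.
- by move=> X Y Z a u v; rewrite h4; ring.
- by move=> X Y Z W; rewrite a12.
- by move=> X Y Z W; rewrite a34.
- by move=> X Y Z W; rewrite pr.
- by move=> X Y Z W; rewrite -!opprD bi oppr0.
- by move=> X Y Z W; rewrite hK.
Qed.

(** * Choice of weights and rigidity *)

Section Rigidity.
Variables (R : realType) (m : nat) (V : vectType R).
Variables (g : {dot V for idfun}) (J : 'End(V)).
Variables (Rm : V -> V -> V -> V -> R) (e : (2 * m).-tuple V).
Hypothesis m2 : (2 <= m)%N.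
Hypothesis JJ : forall X, J (J X) = - X.
Hypothesis gJ : forall X Y, g (J X) (J Y) = g X Y.
Hypothesis hR : kahler_curvature J Rm.
Hypothesis he : orthonormal_basis g e.
Variable alpha : R.
Hypothesis a0 : 0 < alpha.
Hypothesis ale : alpha <= 3 / 2 * (m%:R ^+ 2 - 1).
Hypothesis hA : alpha_nonnegative (2 * m) g Rm alpha.

Let M : R := m%:R.
Let D : R := M ^+ 2 + M.
Let d : R := M ^+ 2 - 1.
Let p : R := (M - 1) / (2 * M).
Let S := scal Rm e.

Let M2 : 2 <= M. Proof. by rewrite ler_nat. Qed.
Let d0 : 0 < d. Proof. by have := M2; rewrite /d; nra. Qed.
Let D1 : 1 <= D. Proof. by have := M2; rewrite /D; nra. Qed.
(** Source of the critical constant: weight 1 on the invariant part and [p] on the other have total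
    mass d + p D = 3/2 d. *)
Let pD : p * D = d / 2.
Proof. by rewrite /p /D /d; field; apply/eqP; move: M2; lra. Qed.
Let p0 : 0 < p.
Proof. by rewrite /p divr_gt0 //; move: M2; lra. Qed.
Let p1 : p <= 2^-1.
Proof. by rewrite /p ler_pdivrMr; move: M2; lra. Qed.

Let weighted q r r' X : g X X = 1 -> 0 <= q <= 1 -> 0 <= r <= 1 ->
  0 <= r' <= 1 -> q * d + r * (D - 1) + r' = alpha ->
  0 <= q * (- p * S) + r * (S - Rm X (J X) X (J X)) + r' * Rm X (J X) X (J X).
Proof.
move=> gX hq hr hr' wa.
apply: (weighted_curvature_ge0 _ JJ gJ hR he hA) => //; first exact: ltnW.
rewrite (ltW a0) natr_dimS20; last exact: ltnW.
rewrite -/M; move: ale M2; rewrite -/M => h1 h2; nra.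
Qed.

Lemma holomorphic_curvature_eq X : g X X = 1 -> Rm X (J X) X (J X) = S / D.
Proof.
move=> gX; set H := Rm X (J X) X (J X).
(* [q] scales the balanced weights 1 and [p] to total mass alpha. With D eps = q p, the smallest
   perturbed weight q p - (D - 1) eps equals eps, and the largest is below 2 q p, hence at most
   1. *)
pose q := alpha / (3 / 2 * d); pose eps := q * p / D.
have d32 : 0 < 3 / 2 * d by have := d0; lra.
have q0 : 0 < q by rewrite divr_gt0.
have q1 : q <= 1 by rewrite ler_pdivrMr ?mul1r.
have Dn : D != 0 by apply/eqP; move: D1; lra.
have qa : q * d * (3 / 2) = alpha.
  by rewrite /q; field; apply/eqP; move: d0; lra.
have eD : eps * D = q * p by rewrite /eps divfK.
have qp0 : 0 < q * p by rewrite mulr_gt0.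
have qp1 : q * p <= 2^-1 by have := p0; have := p1; nra.
have eps0 : 0 < eps by rewrite divr_gt0 //; move: D1; lra.
have eps1 : eps <= q * p by rewrite -eD; move: D1 eps0; nra.
have qpD : q * p * D = q * d / 2 by rewrite -mulrA pD mulrA.
(* Mass eps moves from each of the D - 1 other anti-invariant tensors onto that of X, and the other
   way in [dn]; the two resulting bounds are opposite. *)
have up := @weighted q (q * p - eps) (q * p + eps * (D - 1)) X gX.
have dn := @weighted q (q * p + eps) (q * p - eps * (D - 1)) X gX.
have {}up : 0 <= eps * (D * H - S).
  have -> : eps * (D * H - S) = q * (- p * S) + (q * p - eps) * (S - H) + (q *
    p + eps * (D - 1)) * H by ring.
  by apply: up; try (apply/andP; split); nra.
have {}dn : 0 <= eps * (S - D * H).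
  have -> : eps * (S - D * H) = q * (- p * S) + (q * p + eps) * (S - H) + (q *
    p - eps * (D - 1)) * H by ring.
  by apply: dn; try (apply/andP; split); nra.
move: up dn; rewrite !pmulr_rge0 // => up dn.
apply: (mulIf Dn); rewrite divfK //; lra.
Qed.

Lemma exists_unit : exists X, g X X = 1.
Proof.
have n0 : (0 < 2 * m)%N by lia.
by exists (tnth e (Ordinal n0)); case: he => _ ->; rewrite eqxx.
Qed.

(** Equal weights [q] on the whole basis give q (1 - p) S, with p < 1. *)
Lemma scal_ge0 : 0 <= S.
Proof.
have [X gX] := exists_unit; pose q := alpha / (d + D).
have dD : 0 < d + D by move: d0 D1; lra.
have q0 : 0 < q by rewrite divr_gt0.
have q1 : q <= 1.
  by rewrite ler_pdivrMr // mul1r; move: ale M2; rewrite -/M /d /D; nra.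
have qa : q * (d + D) = alpha by rewrite divfK //; apply: lt0r_neq0.
have := @weighted q q q X gX.
have -> : q * (- p * S) + q * (S - Rm X (J X) X (J X)) + q * Rm X (J X) X (J X)
  = q * (1 - p) * S by ring.
rewrite [0 <= _ * S]pmulr_rge0; last by rewrite mulr_gt0 //; move: p1; lra.
by apply; try (apply/andP; split); lra.
Qed.

Lemma scal_le0 : alpha < 3 / 2 * d -> S <= 0.
Proof.
move=> alt; have [X gX] := exists_unit.
have D0 : 0 < D by move: D1; lra.
have [ad|da] := leP alpha d.
  (* All the mass fits on the invariant part, where the weighted sum is - q p S. *)
  pose q := alpha / d.
  have q0 : 0 < q by rewrite divr_gt0.
  have q1 : q <= 1 by rewrite ler_pdivrMr // mul1r.
  have qa : q * d = alpha by rewrite divfK //; apply: lt0r_neq0.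
  have := @weighted q 0 0 X gX; rewrite !mul0r !addr0 mulNr mulrN mulrA.
  rewrite oppr_ge0 pmulr_rle0; last exact: mulr_gt0 q0 p0.
  by apply; rewrite ?lexx ?ler01 ?(ltW q0) ?q1.
(* The invariant part is saturated and the remaining mass is spread evenly over the rest; r < p
   because alpha - d < d / 2 = p D. *)
pose r := (alpha - d) / D.
have rD : r * D = alpha - d by rewrite divfK //; apply: lt0r_neq0.
have r0 : 0 < r by rewrite divr_gt0 // subr_gt0.
have rp : r < p by rewrite ltr_pdivrMr // pD; lra.
have := @weighted 1 r r X gX.
have -> : 1 * (- p * S) + r * (S - Rm X (J X) X (J X)) + r * Rm X (J X) X (J X)
  = - ((p - r) * S) by ring.
rewrite oppr_ge0 pmulr_rle0; last by lra.
by apply; try (apply/andP; split); move: p1 rD; lra.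
Qed.

Lemma curvature_flat : alpha < 3 / 2 * d -> forall X Y Z W, Rm X Y Z W = 0.
Proof.
move=> alt; apply: (holomorphic_zero_flat JJ hR) => X.
have S0 : S = 0 by apply/le_anti; rewrite scal_le0 // scal_ge0.
have [->|X0] := eqVneq X 0;
  first exact: (scalar_form0 (curvature_lin1 hR _ _ _)).
have gX : 0 < g X X by case: (dot_inner g) => _ _; apply.
have s0 : Num.sqrt (g X X) != 0 by rewrite lt0r_neq0 // sqrtr_gt0.
(* Homogeneity of degree 4 carries the vanishing from unit vectors to all vectors. *)
pose Y := (Num.sqrt (g X X))^-1 *: X.
have gY : g Y Y = 1.
  rewrite /Y (scalar_formZ (inner_linl (dot_inner g) _)).
  rewrite (scalar_formZ (inner_linr (dot_inner g) _)) mulrA -expr2 exprVn.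
  by rewrite sqr_sqrtr ?ltW // mulVf // lt0r_neq0.
have -> : X = Num.sqrt (g X X) *: Y by rewrite /Y scalerA mulfV // scale1r.
by rewrite (holomorphic_curvatureZ hR) holomorphic_curvature_eq // S0 mul0r
  mulr0.
Qed.

Lemma constant_holomorphic_ge0 :
  exists2 c : R, 0 <= c & constant_holomorphic_curvature g J Rm c.
Proof.
exists (S / D); last exact: holomorphic_curvature_eq.
by rewrite divr_ge0 ?scal_ge0 //; move: D1; lra.
Qed.

End Rigidity.

(** * Both signs, at and below the critical value *)

Theorem proposition5p1 (R : realType) (m : nat) (V : vectType R)
    (g : {dot V for idfun}) (J : 'End(V)) (Rm : V -> V -> V -> V -> R)
    (hm : (2 <= m)%N) (hV : complex_euclidean m g J)
    (hR : kahler_curvature J Rm) :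
  let n := (2 * m)%N in
  let alpha0 : R := 3%:R / 2%:R * (m%:R ^+ 2 - 1) in
  ((alpha_nonnegative n g Rm alpha0 ->
      exists2 c : R, 0 <= c & constant_holomorphic_curvature g J Rm c) /\
   (alpha_nonpositive n g Rm alpha0 ->
      exists2 c : R, c <= 0 & constant_holomorphic_curvature g J Rm c)) /\
  (forall alpha : R, 1 <= alpha <= (dimS20 n)%:R -> alpha < alpha0 ->
     alpha_nonnegative n g Rm alpha \/ alpha_nonpositive n g Rm alpha ->
     forall X Y Z W, Rm X Y Z W = 0).
Proof.
move=> n alpha0; case: hV => dV JJ gJ.
have [e he] := orthonormal_basis_exists g dV.
have hR' := kahler_curvatureN hR.
have a0 : 0 < alpha0.
  have : 2 <= m%:R :> R by rewrite ler_nat.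
  by rewrite /alpha0; nra.
split; first split.
- exact: (constant_holomorphic_ge0 hm JJ gJ hR he a0 (lexx _)).
- move=> /(constant_holomorphic_ge0 hm JJ gJ hR' he a0 (lexx _))[c c0 hc].
  exists (- c); first by rewrite oppr_le0.
  by move=> X /hc <-; rewrite opprK.
move=> alpha /andP[a1 _] alt.
have apos : 0 < alpha by apply: lt_le_trans a1.
case=> hA.
  exact: (curvature_flat hm JJ gJ hR he apos (ltW alt) hA).
move=> X Y Z W; apply/eqP; rewrite -oppr_eq0; apply/eqP.
exact: (curvature_flat hm JJ gJ hR' he apos (ltW alt) hA).
Qed.
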